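(* Let $G$ be a countable infinite discrete group acting by homeomorphisms on a compact Hausdorff space $X$. If the action $G\curvearrowright X$ is residually topologically free, then every closed ideal of $\ell^1(G\curvearrowright X)$ is self-adjoint.
   Context: Write $\sigma_s:X\to X$ for the homeomorphism given by $s\in G$, $e$ for the identity of $G$, and $C(X)$ for the continuous functions $X\to\mathbb{C}$ with the supremum norm $\|\cdot\|_\infty$. Set $\alpha_s(f)(x)=f(\sigma_s^{-1}(x))$ for $s\in G$, $f\in C(X)$, $x\in X$. $\ell^1(G\curvearrowright X)$ is the Banach $*$-algebra of all functions $f:G\to C(X)$ with $\|f\|=\sum_{s\in G}\|f(s)\|_\infty<\infty$, with pointwise linear operations, product $(fg)(s)=\sum_{t\in G}f(t)\,\alpha_t(g(t^{-1}s))$ and involution $(f^* )(s)=\alpha_s(\overline{f(s^{-1})})$. ''Ideal'' means two-sided ideal. An ideal $I$ is self-adjoint if $f^*\in I$ for every $f\in I$. An action of $G$ on a space $Y$ by homeomorphisms is topologically free if the set of points of $Y$ not fixed by any $s\in G\setminus\{e\}$ is dense in $Y$. The action $G\curvearrowright X$ is residually topologically free if for every closed $G$-invariant subset $D$ of $X$ the restricted action $G\curvearrowright D$ is topologically free. *)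

(* Defs.v *)
From HB Require Import structures.
From mathcomp Require Import all_boot all_order all_algebra finmap.
From mathcomp Require Import all_classical all_reals all_analysis.
From mathcomp Require Import complex.
From mathcomp.analysis Require Import showcase.summability.

Set Implicit Arguments.
Unset Strict Implicit.
Unset Printing Implicit Defensive.

Import Order.TTheory GRing.Theory Num.Theory.
Import numFieldNormedType.Exports.
Local Open Scope classical_set_scope.
Local Open Scope ring_scope.

(* Each [sigma s] is a homeomorphism, its inverse being [sigma s^-1]. *)
Record is_action (G : groupType) (Y : topologicalType) (sigma : G -> Y -> Y) :
    Prop := IsAction {
  action1 : forall y, sigma 1%g y = y;
  actionM : forall s t y, sigma (s * t)%g y = sigma s (sigma t y);
  action_continuous : forall s, continuous (sigma s) }.

Definition invariant_set (G : groupType) (Y : topologicalType)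
    (sigma : G -> Y -> Y) (D : set Y) :=
  forall s y, D y -> D (sigma s y).

(* [D], coerced to the type [set_type D], carries the subspace topology. *)
Definition restrict_action (G : groupType) (Y : topologicalType)
    (sigma : G -> Y -> Y) (D : set Y) (hD : invariant_set sigma D)
    (s : G) (y : D) : D :=
  SigSub (mem_set (hD s (\val y) (set_mem (valP y)))).

Definition topologically_free (G : groupType) (Y : topologicalType)
    (sigma : G -> Y -> Y) :=
  dense [set y | forall s, s <> 1%g -> sigma s y <> y].

Definition residually_topologically_free (G : groupType) (Y : topologicalType)
    (sigma : G -> Y -> Y) :=
  forall (D : set Y) (hD : invariant_set sigma D),
    closed D -> topologically_free (restrict_action hD).

(* [R[i]] is the field of complex numbers over [R]; the alias [R[i]^o] is the
   one that carries its usual topology.  [C(X)] is represented by the continuous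
   functions in [X -> R[i]^o], and functions from [G] to [C(X)] by
   [G -> X -> R[i]^o]. *)
Section ell1.
Context (R : realType) (G : groupType) (X : topologicalType).
Variable sigma : G -> X -> X.
Implicit Types (f g : G -> X -> R[i]^o) (I : set (G -> X -> R[i]^o)).

(* The supremum is that of [R], so that the norm is 0 when [X] is empty. *)
Definition sup_norm (h : X -> R[i]^o) : R :=
  sup [set complex.Re `|h x| | x in [set: X]].

Definition ell1_norm f : \bar R :=
  \esum_(s in [set: G]) (sup_norm (f s))%:E.

Definition ell1 : set (G -> X -> R[i]^o) :=
  [set f | (forall s, continuous (f s)) /\ (ell1_norm f < +oo)%E].

Definition alpha (s : G) (h : X -> R[i]^o) : X -> R[i]^o :=
  fun x => h (sigma s^-1%g x).

(* Unconditional sum for the supremum norm: the limit, for uniform convergence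
   on [X], of the net of partial sums over the finite subsets of [G] (and 0 when
   there is no such limit). *)
Definition uniform_sum (u : G -> X -> R[i]^o) : X -> R[i]^o :=
  xget 0 [set h | {uniform, partial_sum u @ totally --> h}].

Definition ell1_mul f g : G -> X -> R[i]^o :=
  fun s => uniform_sum (fun t x => f t x * alpha t (g (t^-1 * s)%g) x).

Definition ell1_star f : G -> X -> R[i]^o :=
  fun s => alpha s (fun x => (f s^-1%g x)^*).

Record is_ideal I : Prop := IsIdeal {
  ideal_sub : I `<=` ell1;
  ideal0 : I 0;
  idealD : forall f g, I f -> I g -> I (f + g);
  idealZ : forall (a : R[i]) f, I f -> I (fun s x => a * f s x);
  idealMl : forall f g, ell1 f -> I g -> I (ell1_mul f g);
  idealMr : forall f g, I f -> ell1 g -> I (ell1_mul f g) }.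

Definition ell1_closed I :=
  forall f, ell1 f ->
    (forall e : R, 0 < e -> exists2 g, I g & (ell1_norm (f - g)%R < e%:E)%E) ->
    I f.

Definition selfadjoint I := forall f, I f -> I (ell1_star f).

End ell1.

(* Main.v *)
(* A closed ideal I is determined by its hull D, the set of common zeros of
   the intersection of I with C(X): it consists of the f all of whose values f s
   vanish on D, a self-adjoint condition since D is invariant.  That such f are in I
   follows from the description of the closed ideals of C(X) and from closedness.
   Conversely, Kaplansky's minimality of the uniform norm shows that the quotient
   norm of ell1 / I dominates the supremum norm over D on C(X).  If x in D is a free
   point and f is in I, choose h in C(X) with h x = 1 whose support is disjoint from
   its translates by the finitely many s <> 1 that carry most of the norm of f: the
   element h f h of I is close to h^2 (f 1) in C(X), so that f 1 vanishes at x.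
   Free points are dense in D, and f s is the value at 1 of f times delta_(s^-1). *)

Require Import Defs.
From HB Require Import structures.
From mathcomp Require Import all_boot all_order all_algebra finmap.
From mathcomp Require Import all_classical all_reals all_analysis.
From mathcomp Require Import complex.
From mathcomp Require Import ring lra.
From mathcomp.analysis Require Import showcase.summability.

Set Implicit Arguments.
Unset Strict Implicit.
Unset Printing Implicit Defensive.

Import Order.TTheory GRing.Theory Num.Theory.
Import numFieldNormedType.Exports.
Local Open Scope classical_set_scope.
Local Open Scope ring_scope.

(** * The modulus of complex numbers as a real number *)

Section modulus.
Context {R : realType}.
Implicit Types z w : R[i]^o.

(** The norm of [R[i]] takes its values in [R[i]]. Its real part allows estimates in [R], where
    suprema exist, and is the expression under the supremum in [sup_norm]. *)
Definition cabs z : R := complex.Re `|z|.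

Lemma cabsE z : (cabs z)%:C%C = `|z| :> R[i].
Proof. by rewrite /cabs normc_def. Qed.

Lemma cabs_ge0 z : 0 <= cabs z.
Proof. by rewrite -lecR cabsE normr_ge0. Qed.

Lemma cabs0 : cabs 0 = 0.
Proof. by apply: complexI; rewrite cabsE normr0. Qed.

Lemma cabs0_eq0 z : cabs z = 0 -> z = 0.
Proof. by move=> z0; apply/normr0_eq0; rewrite -cabsE z0. Qed.

Lemma cabsD z w : cabs (z + w) <= cabs z + cabs w.
Proof. by rewrite -lecR rmorphD/= !cabsE ler_normD. Qed.

Lemma cabsM z w : cabs (z * w) = cabs z * cabs w.
Proof. by apply: complexI; rewrite rmorphM/= !cabsE normrM. Qed.

Lemma cabsV z : cabs z^-1 = (cabs z)^-1.
Proof. by apply: complexI; rewrite fmorphV/= !cabsE normfV. Qed.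

Lemma cabsN z : cabs (- z) = cabs z.
Proof. by apply: complexI; rewrite !cabsE normrN. Qed.

Lemma cabs_conj z : cabs z^* = cabs z.
Proof. by apply: complexI; rewrite !cabsE norm_conjC. Qed.

Lemma cabs_real (x : R) : cabs x%:C%C = `|x|.
Proof. by apply: complexI; rewrite cabsE normc_def/= expr0n addr0 sqrtr_sqr. Qed.

Lemma nbhs_cabsP z (P : set R[i]^o) :
  nbhs z P <-> exists2 e : R, 0 < e & forall w, cabs (z - w) < e -> P w.
Proof.
split.
  move=> /nbhs_ballP[e /= e0 eP].
  (* The radius of a ball is an element of [R[i]]; being positive, it is real. *)
  have eE : e = (complex.Re e)%:C%C.
    by apply/eqP; rewrite eq_complex/= eqxx/=; move: e0; rewrite ltcE => /andP[].
  exists (complex.Re e); first by rewrite -ltcR -eE.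
  by move=> w zw; apply: eP; rewrite /ball/= -cabsE eE ltcR.
move=> [e e0 eP]; apply/nbhs_ballP; exists (e%:C)%C => /=.
  by rewrite ltcR.
by move=> w; rewrite /ball/= -cabsE ltcR => ?; exact: eP.
Qed.

Lemma cabs_continuous : continuous cabs.
Proof.
move=> z P /nbhs_ballP[e e0 eP]; apply/nbhs_cabsP; exists e => // w zw.
apply/eP/le_lt_trans/zw; rewrite ler_norml; apply/andP; split.
  rewrite lerNl opprB lerBlDr -[cabs (z - w)]cabsN opprB.
  by have := cabsD (w - z) z; rewrite subrK.
by rewrite lerBlDr; have := cabsD (z - w) w; rewrite subrK.
Qed.

Lemma real_complex_continuous : continuous ((fun x => x%:C%C) : R -> R[i]^o).
Proof.
move=> x P /nbhs_cabsP[e e0 eP]; apply/nbhs_ballP; exists e => // y xy.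
by apply: eP; rewrite -rmorphB/= cabs_real.
Qed.

Lemma conjC_continuous : continuous ((fun z => z^*) : R[i]^o -> R[i]^o).
Proof.
move=> z P /nbhs_cabsP[e e0 eP]; apply/nbhs_cabsP; exists e => // w zw.
by apply: eP; rewrite -rmorphB/= cabs_conj.
Qed.

End modulus.

(** * The supremum norm on a compact space *)

Section sup_norm.
Context {R : realType} {X : topologicalType}.
Hypothesis compactX : compact [set: X].
Implicit Types h : X -> R[i]^o.

Lemma sup_norm_ubound h x : continuous h -> cabs (h x) <= sup_norm h.
Proof.
move=> ch; apply: ub_le_sup; last by exists x.
have /compact_bounded[M [_ hM]] : compact ((cabs \o h) @` [set: X]).
  apply: continuous_compact => //; apply: continuous_subspaceT => y.
  by apply: continuous_comp; [exact: ch|exact: cabs_continuous].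
exists (M + 1) => _ [y _ <-]; apply: le_trans (ler_norm _) _.
by apply: (hM (M + 1)); [rewrite ltrDl|exists y].
Qed.

Lemma sup_norm_ge0 h : continuous h -> 0 <= sup_norm h.
Proof.
move=> ch; have [[x _]|X0] := pselect (exists x : X, True).
  exact: le_trans (cabs_ge0 (h x)) (sup_norm_ubound x ch).
(* When [X] is empty the set of values is empty, and [sup] takes its default value 0. *)
rewrite /sup_norm sup_out// => -[[_ [x _ _]] _].
by apply: X0; exists x.
Qed.

Lemma sup_norm_le h (M : R) :
  0 <= M -> (forall x, cabs (h x) <= M) -> sup_norm h <= M.
Proof.
move=> M0 hM; have [[x _]|X0] := pselect (exists x : X, True).
  by apply: ge_sup => [|_ [y _ <-]]; [exists (cabs (h x)), x|exact: hM].
rewrite /sup_norm sup_out// => -[[_ [x _ _]] _].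
by apply: X0; exists x.
Qed.

Lemma sup_norm0 : sup_norm (0 : X -> R[i]^o) = 0.
Proof.
apply/eqP; rewrite eq_le sup_norm_ge0 ?andbT; last exact: cst_continuous.
by apply: sup_norm_le => // x; rewrite [X in cabs X]/= cabs0.
Qed.

End sup_norm.

(** * Bounds on the norm of [ell1], and monomials *)

Section ell1_bound.
Context {R : realType} {G : groupType} {X : topologicalType}.
Hypothesis compactX : compact [set: X].
Implicit Types f g : G -> X -> R[i]^o.

(** Bounding all finite partial sums keeps the estimates in [R] and replaces summability arguments
    by inequalities between finite sums. *)
Definition ell1_bounded f (b : R) :=
  forall F : seq G, uniq F -> \sum_(s <- F) sup_norm (f s) <= b.

Lemma ell1_boundedP f b : (ell1_norm f <= b%:E)%E <-> ell1_bounded f b.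
Proof.
split=> [fb F uF|fb].
  rewrite -lee_fin; apply: le_trans fb; rewrite -sumEFin fsbig_seq//.
  by apply: ereal_sup_ubound; exists [set` F] => //; split=> //; exact: finite_seq.
apply: ge_ereal_sup => _ [F [finF _] <-].
by rewrite fsbig_finite//= sumEFin lee_fin; apply/fb/fset_uniq.
Qed.

Lemma ell1P f : ell1 f <->
  (forall s, continuous (f s)) /\ exists b, ell1_bounded f b.
Proof.
split=> [[cf fb]|[cf [b /ell1_boundedP fb]]]; split => //; last first.
  exact: le_lt_trans fb (ltry b).
exists (fine (ell1_norm f)); apply/ell1_boundedP; rewrite fineK//.
rewrite ge0_fin_numE//; apply: esum_ge0 => s _; rewrite lee_fin.
exact: sup_norm_ge0.
Qed.

Lemma ell1_bounded_ge0 f b : ell1_bounded f b -> 0 <= b.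
Proof. by move=> /(_ [::] erefl); rewrite big_nil. Qed.

Lemma ell1_boundedW f a b : a <= b -> ell1_bounded f a -> ell1_bounded f b.
Proof. by move=> ab fa F /fa/le_trans; exact. Qed.

(** An injective [phi] maps duplicate-free lists to duplicate-free lists, so reindexing does not
    enlarge the sums; [psi] can be arbitrary because the supremum norm of [g] is taken over all of
    [X]. This covers scalar multiples, products with monomials and the involution. *)
Lemma ell1_bounded_dom f g (M b : R) (phi : G -> G) (psi : G -> X -> X) :
  0 <= M -> injective phi -> (forall s, continuous (g s)) ->
  (forall s x, cabs (f s x) <= M * cabs (g (phi s) (psi s x))) ->
  ell1_bounded g b -> ell1_bounded f (M * b).
Proof.
move=> M0 phiI cg fg gb F uF.
apply: le_trans (_ : M * \sum_(s <- map phi F) sup_norm (g s) <= _); last first.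
  by rewrite ler_wpM2l// gb// map_inj_uniq.
rewrite big_map mulr_sumr; apply: ler_sum => s _.
apply: sup_norm_le => [|x]; first by rewrite mulr_ge0// sup_norm_ge0.
by apply: le_trans (fg s x) _; rewrite ler_wpM2l// sup_norm_ubound.
Qed.

Lemma ell1_boundedD f g a b :
  (forall s, continuous (f s)) -> (forall s, continuous (g s)) ->
  ell1_bounded f a -> ell1_bounded g b -> ell1_bounded (f + g) (a + b).
Proof.
move=> cf cg fa gb F uF; apply: le_trans (lerD (fa _ uF) (gb _ uF)).
rewrite -big_split/=; apply: ler_sum => s _; apply: sup_norm_le => [|x].
  by rewrite addr_ge0// sup_norm_ge0.
by apply: le_trans (cabsD _ _) _; rewrite lerD// sup_norm_ubound.
Qed.

(** Take [F] whose partial sum is within [e] of the supremum of all partial sums: a finite set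
    disjoint from [F] can then add at most [e]. *)
Lemma ell1_bounded_tail f b (e : R) : (forall s, continuous (f s)) ->
  ell1_bounded f b -> 0 < e ->
  exists2 F : seq G, uniq F &
    ell1_bounded (fun s => if s \in F then 0 else f s) e.
Proof.
move=> cf fb e0.
pose S := [set \sum_(s <- F) sup_norm (f s) | F in [set F : seq G | uniq F]].
have supS : has_sup S.
  by split; [exists 0, [::]; rewrite ?big_nil|exists b => _ [F uF <-]; exact: fb].
have [_ [F /= uF <-] ltF] := sup_adherent e0 supS.
exists F => // F' uF'.
rewrite (bigID (mem F))/= big1 ?add0r => [|s ->]; last exact: sup_norm0.
rewrite (eq_bigr (fun s => sup_norm (f s))) => [|s /negPf -> //].
rewrite -big_filter; set F'' := [seq s <- F' | _].
rewrite -(lerD2l (\sum_(s <- F) sup_norm (f s))) -big_cat/=.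
apply: le_trans (_ : sup S <= _); last by rewrite -lerBlDr ltW.
apply: ub_le_sup; first by case: supS.
exists (F ++ F'') => //=; rewrite cat_uniq uF filter_uniq// andbT/=.
by apply/hasPn => s; rewrite mem_filter => /andP[].
Qed.

(** The partial sums over the finite sets that contain [t0] all equal [u t0], so the net is
    eventually constant. *)
Lemma uniform_sum_single (u : G -> X -> R[i]^o) t0 :
  (forall t, t != t0 -> u t = 0) -> uniform_sum u = u t0.
Proof.
move=> u0.
have totallyF : ProperFilter (@totally G) := totally_filter.
have cvgu : {uniform, partial_sum u @ totally --> u t0}.
  apply: (@cvg_near_cst _ {uniform X -> R[i]^o}); exists [fset t0]%fset => // A /=.
  rewrite fsub1set => tA; rewrite /partial_sum (bigD1 [` tA]%fset)//=.
  rewrite big1 ?addr0// => t /eqP tt0; apply: u0; apply/eqP => tE.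
  by apply: tt0; exact: val_inj.
rewrite /uniform_sum; case: xgetP => [h _ cvgh|/(_ (u t0))//].
(* [xget] may pick any uniform limit; limits are unique because [R[i]^o] is Hausdorff. *)
have := @cvg_close {uniform X -> R[i]^o} _ _ h (u t0) cvgh cvgu.
rewrite hausdorrf_close_eq_in; last first.
  exact: norm_hausdorff.
by move=> hu; apply/funext => x; apply: hu; rewrite inE.
Qed.

(** This is the element c delta_t of the crossed product; the case [t = 1] embeds C(X). *)
Definition monomial (c : X -> R[i]^o) (t : G) : G -> X -> R[i]^o :=
  fun s x => if s == t then c x else 0.

Lemma monomial_continuous c t s : continuous c -> continuous (monomial c t s).
Proof.
by move=> cc; rewrite /monomial; case: (s == t); [exact: cc|exact: cst_continuous].
Qed.

Lemma ell1_bounded_monomial c t : continuous c ->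
  ell1_bounded (monomial c t) (sup_norm c).
Proof.
move=> cc F uF; have [tF|tF] := boolP (t \in F).
  rewrite (bigD1_seq t)//= big1 ?addr0 => [|s /negPf st].
    by rewrite /monomial eqxx.
  by rewrite /monomial st sup_norm0.
rewrite big_seq big1 ?sup_norm_ge0// => s sF.
by rewrite /monomial; case: eqP sF tF => [-> ->//|_ _ _]; exact: sup_norm0.
Qed.

Lemma ell1_monomial c t : continuous c -> ell1 (monomial c t).
Proof.
move=> cc; apply/ell1P; split=> [s|]; first exact: monomial_continuous.
by exists (sup_norm c); exact: ell1_bounded_monomial.
Qed.

End ell1_bound.

(** * Products with a monomial *)

Section monomial_mul.
Context {R : realType} {G : groupType} {X : topologicalType}.
Variable sigma : G -> X -> X.
Implicit Types f g : G -> X -> R[i]^o.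

(** Only the index s t^-1 contributes to the convolution, so no question of convergence arises. All
    products in the proof have a monomial as a factor. *)
Lemma ell1_mul_monomialr f c t : ell1_mul sigma f (monomial c t) =
  fun s x => f (s * t^-1)%g x * c (sigma (s * t^-1)^-1%g x).
Proof.
apply/funext => s; rewrite /ell1_mul (@uniform_sum_single _ _ _ _ (s * t^-1)%g).
  by apply/funext => x; rewrite /alpha /monomial invgF mulgVK eqxx.
move=> r rs; apply/funext => x; rewrite /alpha /monomial; case: eqP => [rt|_].
  by move: rs; rewrite -[s](mulVKg r) rt mulgK eqxx.
by rewrite mulr0.
Qed.

Lemma ell1_mul_monomiall g c t : ell1_mul sigma (monomial c t) g =
  fun s x => c x * g (t^-1 * s)%g (sigma t^-1%g x).
Proof.
apply/funext => s; rewrite /ell1_mul (@uniform_sum_single _ _ _ _ t).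
  by apply/funext => x; rewrite /alpha /monomial eqxx.
move=> r /negPf rt; apply/funext => x.
by rewrite /alpha /monomial rt mul0r.
Qed.

End monomial_mul.

(** * The quotient norm modulo an ideal *)

Section ideal.
Context {R : realType} {G : groupType} {X : topologicalType}.
Variable sigma : G -> X -> X.
Hypothesis compactX : compact [set: X].
Hypothesis actionX : is_action sigma.
Variable I : set (G -> X -> R[i]^o).
Hypothesis idealI : is_ideal sigma I.
Implicit Types (f g r : G -> X -> R[i]^o) (c u : X -> R[i]^o).

Let sigma_continuous s : continuous (sigma s) :=
  @action_continuous _ _ _ actionX s.

Let sigmaV1 x : sigma 1^-1%g x = x.
Proof. by rewrite invg1 action1. Qed.

Lemma continuous_mul c u : continuous c -> continuous u ->
  continuous (fun x => c x * u x : R[i]^o).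
Proof. by move=> cc cu x; apply: cvgM; [exact: cc|exact: cu]. Qed.

Lemma continuous_alpha s c : continuous c -> continuous (alpha sigma s c).
Proof.
by move=> cc x; apply: continuous_comp; [exact: sigma_continuous|exact: cc].
Qed.

Lemma ideal_continuous f s : I f -> continuous (f s).
Proof. by move=> /(Defs.ideal_sub idealI)/(ell1P compactX)[+ _]; exact. Qed.

Lemma ideal_monomialr f c t : I f -> continuous c ->
  I (fun s x => f (s / t)%g x * c (sigma (s / t)^-1%g x)).
Proof.
move=> If cc; have := Defs.idealMr idealI If (ell1_monomial compactX t cc);
  by rewrite ell1_mul_monomialr.
Qed.

Lemma ideal_monomiall f c t : I f -> continuous c ->
  I (fun s x => c x * f (t^-1 * s)%g (sigma t^-1%g x)).
Proof.
move=> If cc; have := Defs.idealMl idealI (ell1_monomial compactX t cc) If;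
  by rewrite ell1_mul_monomiall.
Qed.

Lemma ideal_mul f c : I f -> continuous c -> I (fun s x => c x * f s x).
Proof.
move=> If cc; have := ideal_monomiall 1 If cc.
by under eq_fun do under eq_fun do rewrite sigmaV1 invg1 mul1g.
Qed.

Lemma ideal_sum (F : seq G) (g : G -> G -> X -> R[i]^o) :
  (forall t, t \in F -> I (g t)) -> I (\sum_(t <- F) g t).
Proof.
move=> Ig; rewrite big_seq; elim/big_ind: _ => //; first exact: (Defs.ideal0 idealI).
exact: (Defs.idealD idealI).
Qed.

(** A bound [b] on the quotient norm of the class of [f] modulo [I], in the form of a representative
    that satisfies it. *)
Definition ideal_approx f (b : R) :=
  exists2 i, I i & ell1_bounded (f - i) b.

Lemma ideal_approxW f a b : a <= b -> ideal_approx f a -> ideal_approx f b.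
Proof. by move=> ab [i Ii fi]; exists i => //; exact: ell1_boundedW fi. Qed.

Lemma ideal_approx_bounded f b : ell1_bounded f b -> ideal_approx f b.
Proof. by move=> fb; exists 0; [exact: (Defs.ideal0 idealI)|rewrite subr0]. Qed.

Lemma ideal_approx_ideal f : I f -> ideal_approx f 0.
Proof.
move=> If; exists f => // F _; rewrite subrr big1// => s _.
exact: sup_norm0.
Qed.

Let sub_continuous f i s : continuous (f s) -> I i -> continuous ((f - i) s).
Proof.
move=> cf Ii x; apply: cvgB; first exact: cf.
exact: ideal_continuous.
Qed.

Lemma ideal_approxD f g a b :
  (forall s, continuous (f s)) -> (forall s, continuous (g s)) ->
  ideal_approx f a -> ideal_approx g b -> ideal_approx (f + g) (a + b).
Proof.
move=> cf cg [i Ii fi] [j Ij gj]; exists (i + j); first exact: (Defs.idealD idealI).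
rewrite opprD addrACA; apply: (ell1_boundedD compactX _ _ fi gj) => s.
  exact: (sub_continuous (cf s)).
exact: (sub_continuous (cg s)).
Qed.

Lemma continuous_family_sum (F : seq G) (g : G -> G -> X -> R[i]^o) s :
  (forall t s, continuous (g t s)) -> continuous ((\sum_(t <- F) g t) s).
Proof.
move=> cg; elim: F => [|t F IH]; first by rewrite big_nil; exact: cst_continuous.
by rewrite big_cons => x; exact: (cvgD (cg t s x) (IH x)).
Qed.

Lemma ideal_approx_sum (F : seq G) (g : G -> G -> X -> R[i]^o) (b : G -> R) :
  (forall t s, continuous (g t s)) -> (forall t, ideal_approx (g t) (b t)) ->
  ideal_approx (\sum_(t <- F) g t) (\sum_(t <- F) b t).
Proof.
move=> cg gb; elim: F => [|t F IH].
  by rewrite !big_nil; apply/ideal_approx_ideal/(Defs.ideal0 idealI).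
rewrite !big_cons.
exact: (ideal_approxD (cg t) (fun s => @continuous_family_sum F g s cg)
  (gb t) IH).
Qed.

Lemma ideal_approxZ f (z : R[i]) a : (forall s, continuous (f s)) ->
  ideal_approx f a -> ideal_approx (fun s x => z * f s x) (cabs z * a).
Proof.
move=> cf [i Ii fi]; exists (fun s x => z * i s x); first exact: (Defs.idealZ idealI).
have cfi s : continuous ((f - i) s) := sub_continuous (cf s) Ii.
apply: (ell1_bounded_dom (psi := fun=> id) compactX (cabs_ge0 z) (@inj_id G) cfi _ fi).
by move=> s x; rewrite -cabsM [X in _ <= cabs X]mulrBr.
Qed.

(** The function in the conclusion is the product of [f] by [monomial c t]. The same product of [i]
    stays in the ideal, and the difference is at most [M] times a right translate of [f - i]. *)
Lemma ideal_approx_monomialr f c t (a M : R) : (forall s, continuous (f s)) ->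
  continuous c -> 0 <= M -> (forall x, cabs (c x) <= M) -> ideal_approx f a ->
  ideal_approx (fun s x => f (s / t)%g x * c (sigma (s / t)^-1%g x)) (M * a).
Proof.
move=> cf cc M0 cM [i Ii fi]; have Iit := ideal_monomialr t Ii cc.
have cfi s : continuous ((f - i) s) := sub_continuous (cf s) Ii.
exists (fun s x => i (s / t)%g x * c (sigma (s / t)^-1%g x)); first exact: Iit.
apply: (ell1_bounded_dom (psi := fun=> id) compactX M0 (@divIg _ t) cfi _ fi).
move=> s x; rewrite [X in cabs X](_ : _ =
  (f - i) (s / t)%g x * c (sigma (s / t)^-1%g x)); last by rewrite [RHS]mulrBl.
by rewrite cabsM mulrC ler_wpM2r// cabs_ge0.
Qed.

(* [r] is approximated by a finitely supported function, which reduces the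
   product to monomials. *)
Lemma ideal_approx_mul u r (a b e : R) : continuous u ->
  (forall x, cabs (u x) <= 1) -> (forall s, continuous (r s)) ->
  ideal_approx (monomial u 1%g) a -> ell1_bounded r b -> 0 < e ->
  ideal_approx (fun s x => u x * r s x) (a * b + e).
Proof.
move=> cu u1 cr ua rb e0.
have [F uF Fe] := ell1_bounded_tail compactX cr rb e0.
(* [g t] is the product of [monomial u 1] by [monomial (r t) t], a form to which the quotient bound
   on [u] applies; it is supported at [t], with value [u] times [r t]. *)
pose g t s x := monomial u 1%g (s / t)%g x * r t (sigma (s / t)^-1%g x).
pose tail s : X -> R[i]^o := if s \in F then 0 else r s.
have ctail s : continuous (tail s).
  by rewrite /tail; case: ifP => _; [exact: cst_continuous|exact: cr].
have -> : (fun s x => u x * r s x) =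
    \sum_(t <- F) g t + (fun s x => u x * tail s x).
  apply/funext => s; apply/funext => x; rewrite !fctE fct_sumE fct_sumE.
  have gE t : g t s x = if t == s then u x * r s x else 0.
    rewrite /g /monomial divg_eq1 eq_sym; case: eqP => [->|_]; last by rewrite mul0r.
    by rewrite mulgV sigmaV1.
  under eq_bigr do rewrite gE.
  rewrite -big_mkcond/= /tail; have [sF|sF] := boolP (s \in F).
    rewrite [X in _ + X]mulr0 addr0 -big_filter.
    by rewrite (perm_big [:: s]) ?big_seq1//= filter_pred1_uniq.
  rewrite big_seq_cond big1 ?add0r// => t /andP[tF /eqP ts].
  by move: sF; rewrite -ts tF.
have cg t s : continuous (g t s).
  exact: continuous_mul (monomial_continuous cu) (continuous_alpha (cr t)).
have cutail s : continuous (fun x => u x * tail s x : R[i]^o).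
  exact: continuous_mul cu (ctail s).
apply: (ideal_approxD (fun s => @continuous_family_sum F g s cg) cutail).
(* The term at [t] has quotient norm at most [sup_norm (r t) * a], and these bounds add up to at
   most [a * b]. *)
- apply: (@ideal_approxW _ (\sum_(t <- F) sup_norm (r t) * a)).
    have [i Ii ui] := ua.
    by rewrite -mulr_suml mulrC ler_wpM2l ?rb// (ell1_bounded_ge0 ui).
  apply: (ideal_approx_sum _ cg) => t.
  apply: (ideal_approx_monomialr _ (fun s => monomial_continuous cu) (cr t)
    _ _ ua); first exact: (sup_norm_ge0 compactX (cr t)).
  by move=> x; exact: (sup_norm_ubound compactX x (cr t)).
- apply: ideal_approx_bounded; rewrite -[e]mul1r.
  apply: (ell1_bounded_dom (psi := fun=> id) compactX ler01 (@inj_id G) ctail _ Fe).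
  move=> s x.
  by rewrite cabsM ler_wpM2r// cabs_ge0.
Qed.

(** Submultiplicativity of the quotient norm, up to [e]. With [i] in the ideal at distance at most
    [b] from [c], write u c = u i + u (c - i): the first term is in the ideal, the second is a
    product of [u] by an element of norm at most [b]. *)
Lemma ideal_approx_monomialM c u (a b e : R) : continuous c -> continuous u ->
  (forall x, cabs (u x) <= 1) -> 0 < e ->
  ideal_approx (monomial u 1%g) a -> ideal_approx (monomial c 1%g) b ->
  ideal_approx (monomial (fun x => u x * c x) 1%g) (a * b + e).
Proof.
move=> cc cu u1 e0 ua [i Ii ci].
have cci s : continuous ((monomial c 1%g - i) s).
  exact: (sub_continuous (monomial_continuous cc) Ii).
have := ideal_approx_mul cu u1 cci ua ci e0.
have Iui := ideal_mul Ii cu.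
have cui s : continuous (fun x => u x * i s x : R[i]^o) :=
  ideal_continuous (s := s) Iui.
have cuci s : continuous (fun x => u x * (monomial c 1%g - i) s x : R[i]^o) :=
  continuous_mul cu (cci s).
move=> /(ideal_approxD cui cuci (ideal_approx_ideal Iui)); rewrite add0r.
rewrite (_ : _ + _ = monomial (fun x => u x * c x) 1%g)//.
apply/funext => s; apply/funext => x; rewrite !fctE mulrBr addrC subrK.
by rewrite /monomial; case: ifP; rewrite ?mulr0.
Qed.

End ideal.

(** * Continuity of truncations and moduli *)

Section continuous_functions.
Context {R : realType} {X : topologicalType}.

Lemma continuous_maxl (m : R) (a : X -> R) :
  continuous a -> continuous (fun x => Num.max m (a x)).
Proof.
move=> ca x; have cm : {for x, continuous (fun=> m : R^o)} by exact: cvg_cst.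
exact: (continuous_max cm (ca x)).
Qed.

Lemma continuous_real_complex (w : X -> R) :
  continuous w -> continuous (fun x => (w x)%:C%C : R[i]^o).
Proof.
by move=> cw x; exact: (continuous_comp (cw x) (@real_complex_continuous R (w x))).
Qed.

Lemma continuous_cabs (c : X -> R[i]^o) :
  continuous c -> continuous (fun x => cabs (c x)).
Proof.
by move=> cc x; exact: (continuous_comp (cc x) (@cabs_continuous R (c x))).
Qed.

End continuous_functions.

(** * The hull, and minimality of the uniform norm *)

Section hull.
Context {R : realType} {G : groupType} {X : topologicalType}.
Variable sigma : G -> X -> X.
Hypothesis compactX : compact [set: X].
Hypothesis actionX : is_action sigma.
Variable I : set (G -> X -> R[i]^o).
Hypothesis idealI : is_ideal sigma I.
Hypothesis closedI : ell1_closed I.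
Implicit Types (f : G -> X -> R[i]^o) (c u : X -> R[i]^o).

Definition hull : set X :=
  [set x | forall c, continuous c -> I (monomial c 1%g) -> c x = 0].

Lemma ell1_closed_approx f : ell1 f ->
  (forall e : R, 0 < e -> ideal_approx I f e) -> I f.
Proof.
move=> ef fI; apply: closedI => // e e0.
(* Half of [e], because closedness asks for a strict inequality. *)
have [i Ii fi] := fI _ (divr_gt0 e0 (ltr0Sn R 1)); exists i => //.
move/ell1_boundedP: fi => /le_lt_trans; apply.
by rewrite lte_fin ltr_pdivrMr// ltr_pMr// ltr1n.
Qed.

(* The function [u] peaks at [x] and [c] is close to [c x] on its support, so the
   quotient norm satisfies |c x| |u| <= |u| (|c| + d); moreover |u| > 0, because
   [u x] is not zero and [x] is in the hull. *)
Lemma hull_approx c x (e : R) : continuous c -> hull x ->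
  ideal_approx I (monomial c 1%g) e -> cabs (c x) <= e.
Proof.
move=> cc Dx ce; rewrite leNgt; apply/negP => ltec.
set L := cabs (c x) in ltec.
have e0 : 0 <= e by case: ce => i _ /ell1_bounded_ge0.
have L0 : 0 < L := le_lt_trans e0 ltec.
pose d := (L - e) / 2; have d0 : 0 < d by rewrite divr_gt0// subr_gt0.
pose a y := cabs (c x - c y).
have ca : continuous a.
  by apply: continuous_cabs => y; exact: (cvgB (cvg_cst (c x)) (cc y)).
(* Equal to 1 at [x], and to 0 wherever [c] is at distance at least [d] from [c x]. *)
pose w y := Num.max 0 (1 - a y / d).
have cw : continuous w.
  apply: continuous_maxl => y; apply: (cvgB (cvg_cst (1 : R))).
  exact: (cvgM (ca y) (cvg_cst d^-1)).
pose u y : R[i]^o := (w y)%:C%C.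
have cu : continuous u := continuous_real_complex cw.
have u1 y : cabs (u y) <= 1.
  rewrite cabs_real ger0_norm ?le_max ?lexx// ge_max ler01/=.
  by rewrite gerBl divr_ge0 ?cabs_ge0// ltW.
(* The difference [c x - c y] cut off at modulus [d]: it is bounded by [d] everywhere and unchanged
   where [u] is nonzero. *)
pose v y : R[i]^o := (c x - c y) * (d / Num.max d (a y))%:C%C.
have max0 y : 0 < Num.max d (a y) by rewrite lt_max d0.
have cv : continuous v.
  apply: continuous_mul => [y|]; first exact: (cvgB (cvg_cst (c x)) (cc y)).
  apply: continuous_real_complex => y; apply: (cvgM (cvg_cst d)).
  have max_neq0 : Num.max d (a y) != 0 by rewrite gt_eqF.
  exact: (cvgV max_neq0 (@continuous_maxl R X d a ca y)).
have vd y : cabs (v y) <= d.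
  rewrite cabsM cabs_real -/(a y) ger0_norm; last by rewrite divr_ge0// ltW.
  by rewrite mulrCA ler_piMr ?(ltW d0)// ler_pdivrMr// mul1r le_max lexx orbT.
have uv y : u y * v y = u y * (c x - c y).
  have [ady|dya] := leP (a y) d.
    by rewrite /v (max_idPl _)// divff ?gt_eqF// mulr1.
  rewrite /u /w (max_idPl _) ?mul0r//.
  by rewrite subr_le0 ler_pdivlMr// mul1r ltW.
have cmu (s : G) : continuous (monomial u 1%g s : X -> R[i]^o) := monomial_continuous cu.
(* As (c x) u = u c + u v, a quotient bound [b] on [u] improves to (b e + h + d b) / L. With h = b d
   / 2 and d = (L - e) / 2 this is b (3 L + e) / (4 L). *)
have step (b : R) : 0 < b -> ideal_approx I (monomial u 1%g) b ->
    ideal_approx I (monomial u 1%g) (b * ((3 * L + e) / (4 * L))).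
  move=> b0 ub; pose h := b * d / 2.
  have h0 : 0 < h by rewrite divr_gt0// mulr_gt0.
  have uc := ideal_approx_monomialM compactX actionX idealI cc cu u1 h0 ub ce.
  have uv' := ideal_approx_monomialr compactX idealI 1%g cmu cv (ltW d0) vd ub.
  have cuc (s : G) : continuous (monomial (fun y => u y * c y) 1%g s : X -> R[i]^o).
    exact: (monomial_continuous (continuous_mul cu cc)).
  have cuv (s : G) : continuous (fun y => monomial u 1%g (s / 1)%g y *
      v (sigma (s / 1)^-1%g y) : R[i]^o).
    exact: (continuous_mul (cmu _) (continuous_alpha actionX cv)).
  have cD (s : G) : continuous
      ((monomial (fun y => u y * c y) 1%g + (fun s y => monomial u 1%g (s / 1)%g y *
      v (sigma (s / 1)^-1%g y) : R[i]^o)) s).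
    by move=> y; exact: (cvgD (cuc s y) (cuv s y)).
  have := ideal_approxZ compactX idealI (c x)^-1 cD
    (ideal_approxD compactX idealI cuc cuv uc uv').
  have -> : (fun s y => (c x)^-1 * (monomial (fun z => u z * c z) 1%g +
      (fun s z => monomial u 1%g (s / 1)%g z * v (sigma (s / 1)^-1%g z))) s y) =
      monomial u 1%g.
    apply/funext => s; apply/funext => y; rewrite !fctE divg1 /monomial.
    case: eqP => [->|_]; last by rewrite mul0r addr0 mulr0.
    rewrite invg1 (action1 actionX) uv -mulrDr addrC subrK mulrCA.
    rewrite mulVf ?mulr1//; apply/eqP => cx0.
    by move: L0; rewrite /L cx0 cabs0 ltxx.
  apply: ideal_approxW; rewrite cabsV -/L le_eqVlt; apply/orP; left; apply/eqP.
  by rewrite /h /d; field; rewrite gt_eqF.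
pose q := (3 * L + e) / (4 * L).
have q0 : 0 < q by rewrite divr_gt0 ?mulr_gt0// ltr_wpDr// mulr_gt0.
have q1 : q < 1 by rewrite ltr_pdivrMr ?mulr_gt0//; lra.
have uq n : ideal_approx I (monomial u 1%g) (q ^+ n).
  elim: n => [|n IH].
    apply/(ideal_approx_bounded idealI)/(ell1_boundedW _
      (@ell1_bounded_monomial _ G _ compactX u 1%g cu)).
    exact: sup_norm_le.
  by rewrite exprSr; apply: step => //; rewrite exprn_gt0.
(* The bounds [q ^+ n] tend to 0, since [e < L] gives [q < 1]; so the closed ideal contains [u],
   although [u x = 1]. *)
have Iu : I (monomial u 1%g).
  apply: ell1_closed_approx => [|r r0]; first exact: ell1_monomial cu.
  have qn1 : `|q| < 1 by rewrite gtr0_norm.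
  have /cvgr0_norm_lt/(_ _ r0)[n _ /(_ n (leqnn n)) qn] := cvg_expr qn1.
  apply: ideal_approxW (uq n); apply/ltW; apply: le_lt_trans qn.
  exact: ler_norm.
have /eqP := Dx u cu Iu.
rewrite /u /w /a subrr cabs0 mul0r subr0 (max_idPr _)// => /eqP/complexI/eqP.
by rewrite oner_eq0.
Qed.

End hull.

(** * Functions vanishing on the hull *)

Section hull_ideal.
Context {R : realType} {G : groupType} {X : topologicalType}.
Variable sigma : G -> X -> X.
Hypothesis compactX : compact [set: X].
Hypothesis actionX : is_action sigma.
Variable I : set (G -> X -> R[i]^o).
Hypothesis idealI : is_ideal sigma I.
Hypothesis closedI : ell1_closed I.
Implicit Types (f : G -> X -> R[i]^o) (c k : X -> R[i]^o).

Lemma monomial1_mul c k : continuous c ->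
  I (monomial k 1%g) -> I (monomial (fun x => c x * k x) 1%g).
Proof.
move=> cc Ik; have := ideal_mul compactX actionX idealI Ik cc.
congr I; apply/funext => s; apply/funext => x.
by rewrite /monomial; case: ifP => // _; rewrite mulr0.
Qed.

Lemma monomial1_sum (T : Type) (F : seq T) (k : T -> X -> R[i]^o) :
  (forall t, I (monomial (k t) 1%g)) ->
  I (monomial (fun x => \sum_(t <- F) k t x) 1%g).
Proof.
move=> Ik; elim: F => [|t F IH].
  have := Defs.ideal0 idealI; congr I; apply/funext => s; apply/funext => x.
  by rewrite /monomial big_nil; case: ifP.
have := Defs.idealD idealI (Ik t) IH; congr I.
apply/funext => s; apply/funext => x; rewrite !fctE /monomial big_cons.
by case: ifP; rewrite ?addr0.
Qed.

Lemma closed_hull : closed (hull I).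
Proof.
have -> : hull I = \bigcap_(c in [set c | continuous c /\ I (monomial c 1%g)])
    (cabs \o c) @^-1` [set 0].
  apply/seteqP; split=> [x Dx c [cc Ic]|x Dx c cc Ic].
    by rewrite /= (Dx c cc Ic) cabs0.
  exact/cabs0_eq0/(Dx c (conj cc Ic)).
apply: closed_bigI => c [cc _]; apply: closed_comp => [x _|].
  exact: (continuous_cabs cc).
exact: closed_eq.
Qed.

(** The product of delta_(s^-1), [c] and delta_s is the composite of [c] with [sigma s], which is
    thus again in the ideal and vanishes on the hull. *)
Lemma invariant_hull : invariant_set sigma (hull I).
Proof.
move=> s x Dx c cc Ic; apply: (Dx (fun y => c (sigma s y))).
  by move=> y; exact: (continuous_comp (@action_continuous _ _ _ actionX s y)
    (cc (sigma s y))).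
have c1 : continuous ((fun=> 1) : X -> R[i]^o) by exact: cst_continuous.
have := ideal_monomialr compactX idealI s
  (ideal_monomiall compactX idealI s^-1%g Ic c1) c1.
congr I; apply/funext => t; apply/funext => y.
rewrite mulr1 mul1r !invgK /monomial mulgA divg_eq1.
by rewrite -[X in _ == X]mulg1 (inj_eq (@mulgI _ s)).
Qed.

(* With |c| <= M and p = \sum |k_i|^2 >= M / e on {|c| >= e}, where the k_i are in
   the ideal, the function c p / (p + 1) is in the ideal and e-close to c. *)
Lemma hull_vanishing c : continuous c -> (forall x, hull I x -> c x = 0) ->
  I (monomial c 1%g).
Proof.
move=> cc c0; apply: (ell1_closed_approx closedI) => [|e e0].
  exact: (ell1_monomial compactX).
pose M := sup_norm c.
have M0 : 0 <= M := sup_norm_ge0 compactX cc.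
pose N := M / e; have N0 : 0 <= N by rewrite divr_ge0// ltW.
pose Z := [set x | e <= cabs (c x)].
have compactZ : compact Z.
  apply: (subclosed_compact _ compactX) => //.
  apply: (@closed_comp _ _ (fun x => cabs (c x)) [set r | e <= r]).
    by move=> x _; exact: (continuous_cabs cc).
  exact: closed_ge.
have /choice[k kP] : forall x, exists k, [/\ continuous k, I (monomial k 1%g) &
    Z x -> N < cabs (k x) ^+ 2].
  move=> x; have [Zx|nZx] := pselect (Z x); last first.
    exists 0; split; [exact: cst_continuous| |by move=> /nZx].
    have := Defs.ideal0 idealI; congr I; apply/funext => s; apply/funext => y.
    by rewrite /monomial; case: ifP.
  have : ~ hull I x.
    by move=> /c0 cx0; move: Zx; rewrite /Z/= cx0 cabs0 leNgt e0.
  move=> /existsNP[h /not_implyP[ch /not_implyP[Ih hx]]].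
  have hx0 : 0 < cabs (h x).
    by rewrite lt_neqAle cabs_ge0 andbT eq_sym; apply/eqP => /cabs0_eq0.
  (* The factor gives [k] the modulus [N + 1] at [x], whose square exceeds [N]. *)
  have cz : continuous ((fun=> ((N + 1) / cabs (h x))%:C%C) : X -> R[i]^o).
    exact: cst_continuous.
  exists (fun y => ((N + 1) / cabs (h x))%:C%C * h y); split.
  - exact: (continuous_mul cz ch).
  - exact: monomial1_mul.
  - move=> _; rewrite cabsM cabs_real ger0_norm; last first.
      by rewrite divr_ge0 ?cabs_ge0// addr_ge0.
    by rewrite divfK ?gt_eqF//; nra.
have ck x : continuous (k x) by have [] := kP x.
have Ik x : I (monomial (k x) 1%g) by have [] := kP x.
(* Compactness in filter form, along finite sets of points ordered by inclusion: near each [x] in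
   [Z] the function [k x] is large, and [F] eventually contains [x]. *)
have [F _ /(_ F (fsubset_refl F)) ZF] : \forall F \near @totally X,
    Z `<=` (fun x => exists2 y, y \in F & N < cabs (k y x) ^+ 2).
  have /compact_near_coveringP covZ := compactZ.
  have totallyF : Filter (@totally X) by have [] := @totally_filter X.
  apply: (covZ _ _ (fun (F : {fset X}) x =>
    exists2 y, y \in F & N < cabs (k y x) ^+ 2) totallyF).
  move=> x Zx.
  exists ([set z | N < cabs (k x z) ^+ 2], [set A : {fset X} | x \in A]); last first.
    by case=> z A /= [Nz xA]; exists x.
  split; last by exists [fset x]%fset => // A; rewrite /= fsub1set.
  have [_ _ /(_ Zx) Nx] := kP x.
  have ck2 := continuous_comp (@continuous_cabs R X (k x) (ck x) x)
    (@exprn_continuous R 2 _).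
  exact: ck2 (lt_nbhsr Nx).
pose p x := \sum_(y <- enum_fset F) cabs (k y x) ^+ 2.
have p0 x : 0 <= p x by apply: sumr_ge0 => y _; exact: sqr_ge0.
have pN x : Z x -> N <= p x.
  move=> /ZF[y yF /ltW/le_trans]; apply.
  by rewrite /p (big_rem y)//= lerDl sumr_ge0// => z _; exact: sqr_ge0.
have cp : continuous p.
  rewrite /p; elim: (enum_fset F) => [|y s IH].
    by under eq_fun do rewrite big_nil; exact: cst_continuous.
  under eq_fun do rewrite big_cons.
  move=> x; apply: (cvgD _ (IH x)).
  exact: (continuous_comp (@continuous_cabs R X (k y) (ck y) x)
    (@exprn_continuous R 2 _)).
have p1 x : 0 < p x + 1 by rewrite ltr_wpDl.
(* The error c - c p / (p + 1). The approximant is g p, a sum of multiples of the [k y], because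
   |k|^2 is the conjugate of k times k. *)
pose g x : R[i]^o := c x * ((p x + 1)^-1)%:C%C.
have cg : continuous g.
  apply: (continuous_mul cc); apply: continuous_real_complex => x.
  have p1_neq0 : p x + 1 != 0 by rewrite gt_eqF.
  exact: (cvgV p1_neq0 (cvgD (cp x) (cvg_cst (1 : R)))).
exists (monomial (fun x => \sum_(y <- enum_fset F) (g x * (k y x)^*) * k y x) 1%g).
  apply: monomial1_sum => y; apply: (monomial1_mul _ (Ik y)).
  apply: (continuous_mul cg) => x.
  exact: (continuous_comp (ck y x) (@conjC_continuous R (k y x))).
have -> : monomial c 1%g -
    monomial (fun x => \sum_(y <- enum_fset F) (g x * (k y x)^*) * k y x) 1%g =
    monomial g (1%g : G).
  apply/funext => s; apply/funext => x; rewrite !fctE /monomial.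
  case: ifP => _; last by rewrite subr0.
  under eq_bigr => y _ do rewrite -mulrA [_^* * _]mulrC -normCK -cabsE -rmorphXn.
  rewrite -mulr_sumr -rmorph_sum/= -/(p x).
  rewrite -[c x](divfK (x := (p x + 1)%:C%C)); last first.
    by apply/eqP => /complexI/eqP; rewrite gt_eqF.
  by rewrite /g fmorphV/= -mulrBr rmorphD/= rmorph1 addrAC subrr add0r mulr1.
apply: (ell1_boundedW _ (@ell1_bounded_monomial _ _ _ compactX _ 1%g cg)).
apply: sup_norm_le => [|x]; first exact: ltW.
rewrite cabsM cabs_real ger0_norm ?invr_ge0 ?(ltW (p1 x))// ler_pdivrMr//.
(* On [Z], |c| <= M = e N <= e p; elsewhere |c| < e. Both are at most e (p + 1). *)
have [/pN Np|] := leP e (cabs (c x)).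
  apply: (le_trans (sup_norm_ubound compactX x cc)).
  by rewrite -/M -ler_pdivrMl// mulrC ler_wpDr.
by move=> /ltW/le_trans; apply; rewrite ler_pMr// lerDr.
Qed.

End hull_ideal.

(** * Urysohn functions displaced by a map *)

Section displacing_function.
Context {R : realType} {X : topologicalType}.
Hypothesis compactX : compact [set: X].
Hypothesis hausdorffX : hausdorff_space X.

(** Take a Urysohn function [g] with value 1 at [x] and 0 at [phi x], and let [h] be nonzero only
    where g > 1/2 and g o phi < 1/2. At [z], h z <> 0 forces g (phi z) < 1/2, whereas h (phi z) <> 0
    forces g (phi z) > 1/2. *)
Lemma displacing_function (phi : X -> X) x : continuous phi -> phi x <> x ->
  exists h : X -> R, [/\ continuous h, forall z, 0 <= h z <= 1, h x = 1 &
    forall z, h z * h (phi z) = 0].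
Proof.
move=> cphi phix.
have closed1 (y : X) : closed [set y].
  exact/accessible_closed_set1/hausdorff_accessible.
have disj : [set phi x] `&` [set x] = set0.
  by apply/disjoints_subset => y /= -> /=.
have /(@normal_separatorP R) sep := compact_normal hausdorffX compactX.
have /(@uniform_separatorP _ R)[g [cg g01 g0 g1]] :=
  sep _ _ (closed1 _) (closed1 _) disj.
have {}g0 : g (phi x) = 0 by apply: g0; exists (phi x).
have {}g1 : g x = 1 by apply: g1; exists x.
have {}g01 z : 0 <= g z <= 1.
  by have := g01 (g z); rewrite set_itvE/=; apply; exists z.
have cgphi : continuous (fun z => g (phi z)).
  by move=> z; exact: (continuous_comp (cphi z) (cg (phi z))).
exists (fun z => Num.max 0 (2 * g z - 1) * Num.max 0 (1 - 2 * g (phi z))); split.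
- move=> z; apply: cvgM.
    apply: (@continuous_maxl R X 0 (fun z => 2 * g z - 1)) => y.
    by apply: (cvgB _ (cvg_cst (1 : R))); exact: (cvgM (cvg_cst (2 : R)) (cg y)).
  apply: (@continuous_maxl R X 0 (fun z => 1 - 2 * g (phi z))) => y.
  apply: (cvgB (cvg_cst (1 : R))).
  exact: (cvgM (cvg_cst (2 : R)) (cgphi y)).
- move=> z; have /andP[gz0 gz1] := g01 z; have /andP[gp0 gp1] := g01 (phi z).
  have le1 (a : R) : a <= 1 -> 0 <= Num.max 0 a <= 1.
    by move=> a1; rewrite le_max lexx ge_max ler01 a1.
  have /andP[a0 a1] : 0 <= Num.max 0 (2 * g z - 1) <= 1 by apply: le1; lra.
  have /andP[b0 b1] : 0 <= Num.max 0 (1 - 2 * g (phi z)) <= 1 by apply: le1; lra.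
  by rewrite mulr_ge0//= mulr_ile1.
- by rewrite g0 g1 !(max_idPr _); lra.
- move=> z; have [gz|gz] := leP (1 - 2 * g (phi z)) 0; first by rewrite mulr0 mul0r.
  by rewrite [X in _ * (X * _)](max_idPl _) ?mul0r ?mulr0//; lra.
Qed.

End displacing_function.

(** * Free points, and closed ideals as sets of functions vanishing on the hull *)

Section free.
Context {R : realType} {G : groupType} {X : topologicalType}.
Variable sigma : G -> X -> X.
Hypothesis compactX : compact [set: X].
Hypothesis hausdorffX : hausdorff_space X.
Hypothesis actionX : is_action sigma.

(** Multiply the functions obtained for each [s] in [F] other than 1. The inverse appears because
    the value at [s] of the product h f h is h (f s) (h o sigma s^-1). *)
Lemma displacing_function_seq (F : seq G) x :
  (forall s, s <> 1%g -> sigma s x <> x) ->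
  exists h : X -> R, [/\ continuous h, forall z, 0 <= h z <= 1, h x = 1 &
    forall s z, s \in F -> s <> 1%g -> h z * h (sigma s^-1%g z) = 0].
Proof.
move=> free; elim: F => [|s F [h [ch h01 hx hF]]].
  exists (fun=> 1); split => // [|z]; first exact: cst_continuous.
  by rewrite ler01 lexx.
have [s1|s1] := pselect (s = 1%g).
  exists h; split; [exact: ch|exact: h01|exact: hx|].
  by move=> t z; rewrite inE => /orP[/eqP ->|/hF]; [rewrite s1|exact].
have sV1 : s^-1%g <> 1%g by move=> /eqP; rewrite invg_eq1 => /eqP.
have [g [cg g01 gx gs]] := displacing_function (R := R) compactX hausdorffX
  (@action_continuous _ _ _ actionX s^-1%g) (free _ sV1).
exists (fun z => g z * h z); split.
- by move=> z; exact: (cvgM (cg z) (ch z)).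
- move=> z; have /andP[gz0 gz1] := g01 z; have /andP[hz0 hz1] := h01 z.
  by rewrite mulr_ge0//= mulr_ile1.
- by rewrite gx hx mulr1.
- move=> t z; rewrite inE => /orP[/eqP -> _|tF t1].
    by rewrite mulrACA gs mul0r.
  by rewrite mulrACA hF// mulr0.
Qed.

Variable I : set (G -> X -> R[i]^o).
Hypothesis idealI : is_ideal sigma I.
Hypothesis closedI : ell1_closed I.
Implicit Types (f : G -> X -> R[i]^o).

Lemma ideal_free_point f x : I f -> hull I x ->
  (forall s, s <> 1%g -> sigma s x <> x) -> f 1%g x = 0.
Proof.
move=> If Dx free; apply: cabs0_eq0; apply/eqP; rewrite eq_le cabs_ge0 andbT.
apply/ler_addgt0Pr => e e0; rewrite add0r.
have [cf [b fb]] : (forall s, continuous (f s)) /\ exists b, ell1_bounded f b.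
  exact/(ell1P compactX)/(ideal_sub idealI).
have [F _ Fe] := ell1_bounded_tail compactX cf fb e0.
have [h [ch h01 hx hF]] := displacing_function_seq F free.
pose k z : R[i]^o := (h z)%:C%C.
have ck : continuous k := continuous_real_complex ch.
have k1 z : cabs (k z) <= 1.
  by have /andP[h0 h1] := h01 z; rewrite cabs_real ger0_norm.
have Ikfk := ideal_monomialr compactX idealI 1%g
  (ideal_mul compactX actionX idealI If ck) ck.
pose c z := k z * k z * f 1%g z.
have cc : continuous c := continuous_mul (continuous_mul ck ck) (cf 1%g).
have cx : c x = f 1%g x by rewrite /c /k hx rmorph1 !mul1r.
rewrite -cx; apply: (hull_approx compactX actionX idealI closedI cc Dx).
(* The element k f k of the ideal. It equals [c] at 1 and vanishes on the rest of [F]; elsewhere |k|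
   <= 1 bounds it by the tail of [f]. *)
exists (fun s z => k z * f (s / 1)%g z * k (sigma (s / 1)^-1%g z)).
  exact: Ikfk.
rewrite -[e]mul1r; pose tail s : X -> R[i]^o := if s \in F then 0 else f s.
have ctail s : continuous (tail s).
  by rewrite /tail; case: ifP => _; [exact: cst_continuous|exact: cf].
apply: (ell1_bounded_dom (psi := fun=> id) compactX ler01 (@inj_id G) ctail _ Fe).
move=> s z; rewrite mul1r !fctE divg1 /monomial.
have [->|/eqP s1] := eqVneq s 1%g.
  by rewrite invg1 (action1 actionX) /c mulrAC subrr cabs0 cabs_ge0.
rewrite sub0r cabsN /tail; case: ifPn => sF.
  by rewrite mulrAC -rmorphM/= hF// mul0r [leLHS]cabs0 cabs_ge0.
rewrite !cabsM -[leRHS]mul1r -[leRHS]mulr1.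
by rewrite ler_pM ?mulr_ge0 ?cabs_ge0// ler_pM ?cabs_ge0.
Qed.

Hypothesis freeX : residually_topologically_free sigma.

Lemma ideal_hull_vanishing f s x : I f -> hull I x -> f s x = 0.
Proof.
have vanish1 g y : I g -> hull I y -> g 1%g y = 0.
  move=> Ig Dy; apply: contrapT => gy.
  have cg : continuous (g 1%g) by exact: (ideal_continuous compactX idealI Ig).
  pose D : set X := hull I.
  have D_invariant : invariant_set sigma D := invariant_hull compactX actionX idealI.
  (* A relatively open subset of the hull that contains [y], hence also a point free for the
     restricted action, where [ideal_free_point] applies. *)
  pose O : set D := [set z | cabs (g 1%g (\val z)) != 0].
  have cval : continuous (\val : D -> X) by exact: initial_continuous.
  have openO : open O.
    apply: (@open_comp _ _ (fun z : D => cabs (g 1%g (\val z))) [set r | r != 0]).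
      move=> z _.
      exact: (continuous_comp (cval z) (@continuous_cabs R X (g 1%g) cg (\val z))).
    exact: open_neq.
  have [|z [Oz free]] := freeX D_invariant (@closed_hull R G X I) _ openO.
    by exists (SigSub (mem_set Dy)); apply/eqP => /cabs0_eq0.
  move: Oz; rewrite /O/= (ideal_free_point Ig) ?cabs0 ?eqxx//.
    exact: set_mem (valP z).
  (* Freeness in the subspace gives freeness in [X], since [\val] is injective. *)
  by move=> t /free + tz; apply; apply: val_inj.
move=> If Dx.
have c1 : continuous ((fun=> 1) : X -> R[i]^o) by exact: cst_continuous.
have := vanish1 _ _ (ideal_monomialr compactX idealI s^-1%g If c1) Dx.
by rewrite mulr1 mul1g invgK.
Qed.

(** Up to [e], [f] is a finite sum of monomials (f t) delta_t. Each is in the ideal, as the product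
    by delta_t of a function that vanishes on the hull. *)
Lemma ideal_vanishing f : ell1 f -> (forall s x, hull I x -> f s x = 0) -> I f.
Proof.
move=> ef f0; apply: (ell1_closed_approx closedI) => // e e0.
have [cf [b fb]] := (ell1P compactX f).1 ef.
have [F uF Fe] := ell1_bounded_tail compactX cf fb e0.
have c1 : continuous ((fun=> 1) : X -> R[i]^o) by exact: cst_continuous.
have If t : I (monomial (f t) t).
  have := ideal_monomialr compactX idealI t
    (hull_vanishing compactX actionX idealI closedI (cf t) (f0 t)) c1.
  congr I; apply/funext => s; apply/funext => x.
  by rewrite mulr1 /monomial divg_eq1.
exists (\sum_(t <- F) monomial (f t) t); first exact: (ideal_sum idealI (fun t _ => If t)).
suff -> : f - \sum_(t <- F) monomial (f t) t = fun s => if s \in F then 0 else f s.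
  exact: Fe.
apply/funext => s; apply/funext => x; rewrite !fctE fct_sumE fct_sumE.
have mE t : monomial (f t) t s x = if t == s then f s x else 0.
  by rewrite /monomial [s == t]eq_sym; have [->|] := eqVneq t s.
under eq_bigr do rewrite mE.
rewrite -big_mkcond/=; have [sF|sF] := boolP (s \in F).
  rewrite -big_filter (perm_big [:: s]) ?big_seq1 ?subrr//=.
  by rewrite filter_pred1_uniq.
rewrite big_seq_cond big1 ?subr0// => t /andP[tF /eqP ts].
by move: sF; rewrite -ts tF.
Qed.

End free.

Unset Implicit Arguments.

Theorem corollary4p2 (R : realType) (G : groupType) (X : topologicalType)
    (sigma : G -> X -> X)
    (countableG : countable [set: G]) (infiniteG : infinite_set [set: G])
    (compactX : compact [set: X]) (hausdorffX : hausdorff_space X)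
    (actionX : is_action sigma)
    (freeX : residually_topologically_free sigma)
    (I : set (G -> X -> R[i]^o)) :
  is_ideal sigma I -> ell1_closed I -> selfadjoint sigma I.
Proof.
(* Membership of the adjoint reduces to its being in [ell1] and vanishing on the hull. *)
move=> idealI closedI f If; apply: (ideal_vanishing compactX actionX idealI closedI).
  have [cf [b fb]] := (ell1P compactX f).1 (ideal_sub idealI If).
  apply/(ell1P compactX); split=> [s|].
    apply: (continuous_alpha actionX) => x.
    exact: (continuous_comp (cf s^-1%g x) (@conjC_continuous R _)).
  (* Inversion permutes [G] and conjugation preserves the modulus, so the bound of [f] carries
     over. *)
  exists (1 * b); apply: (ell1_bounded_dom (psi := fun s => sigma s^-1%g) compactX
    ler01 (@invg_inj G) cf _ fb) => s x.
  by rewrite mul1r cabs_conj.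
move=> s x Dx; rewrite /ell1_star /alpha.
(* The value at [s] and [x] is the conjugate of that of [f] at s^-1 and sigma s^-1 x, a point of the
   hull by invariance. *)
rewrite (ideal_hull_vanishing compactX hausdorffX actionX idealI closedI freeX) ?rmorph0//.
exact: (invariant_hull compactX actionX idealI).
Qed.
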